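(* Let $k$ be a field, $n\ge1$, and let $f\in \mathrm{Aut}(\mathbb{A}^n)$ be a permutation-elementary automorphism of $\mathbb{A}^n=\mathbb{A}^n_k$. If the maximal eigenvalue $\theta$ of $f$ is bigger than $1$, then there exists a maximal eigenvector $\mu$ of $f$ such that $f$ is $\mu$-algebraically stable; in particular, the dynamical degree $\lambda(f)$ is then equal to the maximal eigenvalue $\theta$ of $f$, which is a Handelman number.
   Context: An endomorphism of $\mathbb{A}^n=\mathbb{A}^n_k$ is a tuple $f=(f_1,\ldots,f_n)\in k[x_1,\ldots,x_n]^n$, with composition $(f\circ g)_i=f_i(g_1,\ldots,g_n)$; $f^r$ is the $r$-fold iterate; $\mathrm{Aut}(\mathbb{A}^n)$ is the group of invertible endomorphisms. $\deg(f)=\max_i \deg(f_i)$, and for dominant $f$ the dynamical degree is $\lambda(f)=\lim_{r\to\infty}\deg(f^r)^{1/r}$ (the limit exists). An endomorphism $e$ is elementary if $e_i=x_i$ for $i\in\{1,\ldots,n-1\}$; $\alpha$ is a permutation of the coordinates if $\{\alpha_1,\ldots,\alpha_n\}=\{x_1,\ldots,x_n\}$; $f$ is permutation-elementary if $f=\alpha\circ e$ with $\alpha$ a permutation of the coordinates and $e$ an elementary endomorphism. A Handelman number is a positive real number that is a root of a monic polynomial with integer coefficients all of whose coefficients except the leading one are non-positive. For $\mu=(\mu_1,\ldots,\mu_n)\in(\mathbb{R}_{\ge0})^n\setminus\{0\}$, $\deg_\mu$ on $k[x_1,\ldots,x_n]$ is given by $\deg_\mu(0)=-\infty$ and, for $p\ne0$,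 $\deg_\mu(p)=\max\{\sum_i a_i\mu_i\}$ over all exponents $(a_1,\ldots,a_n)$ of monomials appearing in $p$ with nonzero coefficient. For a nonzero $f\in\mathrm{End}(\mathbb{A}^n)$, $\deg_\mu(f)=\inf\{\theta\in\mathbb{R}_{\ge0}\mid \deg_\mu(f_i)\le\theta\mu_i\text{ for all }i\}$, with $\deg_\mu(f)=\infty$ if this set is empty. $f$ is $\mu$-algebraically stable if $\deg_\mu(f)<\infty$ and $\deg_\mu(f^r)=\deg_\mu(f)^r$ for each $r\ge1$. Let $f\in\mathrm{End}(\mathbb{A}^n)$ with all $f_i\ne0$. A matrix $M=(m_{i,j})\in\mathrm{Mat}_n(\mathbb{N})$ (with $0\in\mathbb{N}$) is contained in $f$ if for each $i$ the coefficient of $\prod_{j=1}^n x_j^{m_{i,j}}$ in $f_i$ is nonzero. The maximal eigenvalue of $f$ is $\theta=\max\{|\xi| \mid \xi\text{ is a (complex) eigenvalue of a matrix contained in } f\}$. A maximal eigenvector of $f$ is an element $\mu\in(\mathbb{R}_{\ge0})^n\setminus\{0\}$ with $\deg_\mu(f_i)=\theta\mu_i$ for each $i$. *)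

(* Defs.v *)
From HB Require Import structures.
From mathcomp Require Import all_boot all_order all_algebra.
From mathcomp Require Import complex.
From mathcomp Require Import -(notations) mpoly.
From mathcomp Require Import all_classical all_reals all_analysis.

Set Implicit Arguments.
Unset Strict Implicit.
Unset Printing Implicit Defensive.

Import Order.TTheory GRing.Theory Num.Theory.
Import numFieldNormedType.Exports.

Local Open Scope classical_set_scope.
Local Open Scope ring_scope.

(* The notations of mpoly and of the analysis library cannot be imported
   together; these are the ones used below. *)
Notation "{ 'mpoly' T [ n ] }" := (mpoly n T)
  (at level 0, T, n at level 2, format "{ 'mpoly'  T [ n ] }") : type_scope.

Section Endomorphisms.
Variables (k : fieldType) (n : nat).
Implicit Types f g : n.-tuple {mpoly k[n]}.

Definition mvar (i : 'I_n) : {mpoly k[n]} :=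
  mpolyX k (mnm1 i).

Definition endo_id : n.-tuple {mpoly k[n]} := [tuple mvar i | i < n].

Definition endo_comp f g : n.-tuple {mpoly k[n]} :=
  [tuple comp_mpoly g (tnth f i) | i < n].

Definition endo_iter f (r : nat) : n.-tuple {mpoly k[n]} :=
  iter r (endo_comp f) endo_id.

Definition is_automorphism f : Prop :=
  exists g, endo_comp f g = endo_id /\ endo_comp g f = endo_id.

(* Indices run from 0, so the last coordinate is the i with i.+1 = n. *)
Definition is_elementary f : Prop :=
  forall i : 'I_n, (i.+1 < n)%N -> tnth f i = mvar i.

(* Equality of the sets of entries. *)
Definition is_coordinate_permutation f : Prop := f =i endo_id.

Definition is_permutation_elementary f : Prop :=
  exists a e, [/\ is_coordinate_permutation a, is_elementary e
                & f = endo_comp a e].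

(* mmeasure mdeg is 1 + the total degree, and 0 on the zero polynomial;
   hence the zero polynomial is given degree 0 here. *)
Definition endo_deg f : nat :=
  (\max_(i < n) (mmeasure (@mdeg n) (tnth f i)).-1)%N.

Definition is_contained (M : 'M[nat]_n) f : Prop :=
  forall i, mcoeff (Multinom [tuple M i j | j < n]) (tnth f i) != 0.

End Endomorphisms.

Section RealInvariants.
Variables (R : realType) (k : fieldType) (n : nat).
Implicit Types (f : n.-tuple {mpoly k[n]}) (mu : 'rV[R]_n) (theta : R).

Definition degree_growth f : R^nat :=
  fun r => (endo_deg (endo_iter f r))%:R `^ (r%:R^-1).

(* limn returns a default value on sequences that do not converge. *)
Definition dynamical_degree f : R := limn (degree_growth f).

Definition eigenvalue_moduli f : set R :=
  [set t | exists (M : 'M[nat]_n) (xi : R[i]),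
     [/\ is_contained M f,
         eigenvalue (map_mx (fun m : nat => m%:R) M) xi
       & `|xi| = (t%:C)%C]].

Definition is_maximal_eigenvalue f theta : Prop :=
  eigenvalue_moduli f theta /\ ubound (eigenvalue_moduli f) theta.

Definition is_weight mu : Prop := (forall i, 0 <= mu 0 i) /\ mu != 0.

(* The support of the zero polynomial is empty, which yields -oo. *)
Definition wdeg mu (p : {mpoly k[n]}) : \bar R :=
  \big[maxe/-oo%E]_(m <- msupp p) (\sum_(i < n) (m i)%:R * mu 0 i)%:E.

(* The infimum of the empty set is +oo in \bar R. *)
Definition endo_wdeg mu f : \bar R :=
  ereal_inf [set theta%:E | theta in
    [set theta | 0 <= theta /\
       forall i, (wdeg mu (tnth f i) <= (theta * mu 0 i)%:E)%E]].

Definition algebraically_stable mu f : Prop :=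
  (endo_wdeg mu f < +oo)%E /\
  forall r, (1 <= r)%N -> endo_wdeg mu (endo_iter f r) = (endo_wdeg mu f ^+ r)%E.

Definition is_maximal_eigenvector f mu : Prop :=
  is_weight mu /\
  exists theta, is_maximal_eigenvalue f theta /\
    forall i, wdeg mu (tnth f i) = (theta * mu 0 i)%:E.

Definition is_Handelman theta : Prop :=
  0 < theta /\
  exists p : {poly int},
    [/\ p \is monic, forall i, (i < (size p).-1)%N -> p`_i <= 0
      & root (map_poly (intr : int -> R) p) theta].

End RealInvariants.

(* The maximum defining the maximal eigenvalue is attained. *)
Lemma maximal_eigenvalue_exists (R : realType) (k : fieldType) (n : nat)
    (f : n.-tuple {mpoly k[n]}) :
  (0 < n)%N -> (forall i, tnth f i != 0) ->
  exists theta : R, is_maximal_eigenvalue f theta.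
Proof.
move=> n0 f0.
pose toC (M : 'M[nat]_n) : 'M[R[i]]_n := map_mx (fun m : nat => m%:R) M.
have fin : finite_set ((eigenvalue_moduli f : set R)).
  pose B := (\max_(i < n) mmeasure (@mdeg n) (tnth f i))%N.
  pose L := [seq complex.Re `|x| | M <- enum {: 'M['I_B.+1]_n},
     x <- sval (closed_field_poly_normal (char_poly (toC (map_mx val M))))].
  apply: (@sub_finite_set _ _ [set` L]); last exact: finite_seq.
  move=> t [M [xi [cM ev xit]]] /=.
  have mB i j : (M i j < B.+1)%N.
    rewrite ltnS.
    apply: leq_trans (leq_bigmax (F := fun i => mmeasure (@mdeg n) (tnth f i)) i).
    have := cM i; rewrite -mcoeff_msupp => /(msize_mdeg_lt).
    apply: leq_trans; rewrite mdegE (bigD1 j) //= mnmE.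
    by rewrite ltnW // ltnS leq_addr.
  pose M' : 'M['I_B.+1]_n := \matrix_(i, j) inord (M i j).
  have MM : map_mx val M' = M.
    by apply/matrixP => i j; rewrite !mxE /= inordK.
  apply/allpairsPdep; exists M', xi; split; rewrite ?mem_enum //; last by rewrite xit.
  case: closed_field_poly_normal => r /= rE.
  move: ev; rewrite eigenvalue_root_char -/(toC M) -MM rE.
  by rewrite (monicP (char_poly_monic _)) scale1r root_prod_XsubC.
have [t0 St0] : exists t0, (eigenvalue_moduli f : set R) t0.
  pose M : 'M[nat]_n := \matrix_(i, j) (mlead (tnth f i) j).
  have [xi rxi] : exists xi, root (char_poly (toC M)) xi.
    by apply/closed_rootP; rewrite size_char_poly; case: (n) n0.
  exists (complex.Re `|xi|), M, xi; split.
  - move=> i; rewrite -mcoeff_msupp.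
    suff -> : Multinom [tuple M i j | j < n] = mlead (tnth f i) by apply: mlead_supp.
    by apply/mnmP => j; rewrite mnmE mxE.
  - by rewrite eigenvalue_root_char.
  - by rewrite normc_def.
have [m [Sm mM]] : exists m, (eigenvalue_moduli f : set R) m /\ ubound ((eigenvalue_moduli f : set R)) m.
  have /finite_seqP[T TE] := fin; rewrite TE in St0 *.
  elim: T {TE} t0 St0 => [//|a T IH] t0 _.
  case: T IH => [|b T] IH.
    by exists a; split => /=; [rewrite inE|move=> x /=; rewrite inE => /eqP ->].
  have [m [mT mub]] := IH b (mem_head _ _).
  case: (leP m a) => am.
    exists a; split; first exact: mem_head.
    by move=> x /=; rewrite inE => /orP[/eqP ->//|/mub]; move/le_trans; apply.
  exists m; split; first by rewrite /= inE mT orbT.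
  by move=> x /=; rewrite inE => /orP[/eqP ->|/mub//]; exact: ltW.
by exists m.
Qed.

(* Main.v *)
Require Import Defs.
From mathcomp Require Import all_boot all_order all_algebra.
From mathcomp Require Import complex ring.
From mathcomp Require Import -(notations) mpoly.
From mathcomp Require Import all_classical all_reals all_analysis.
Import Order.TTheory GRing.Theory Num.Theory.
Import numFieldNormedType.Exports.
Local Open Scope ring_scope.

(* Up to renaming, [f] sends [x_i] to a variable [x_(s i)] for all indices but one,
   [i0], with [s] injective. Every matrix contained in [f] has as characteristic
   polynomial a product of factors [t^c - 1] and of [t^l - sum_j m_j t^(index of j)],
   where [l] is the length of the cycle of [s] through [i0], [j] runs over that
   cycle, and [m] is a monomial of [f_i0]. Hence the weight [w] equal to the powers
   of [theta] along the cycle and to 0 off it is a maximal eigenvector.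

   For this weight the leading part [g] of [f] is homogeneous, so [f] is stable as
   soon as no iterate of [g] vanishes at [i0]. Although [g] is not dominant in
   general, it is so on the variables of the cycle from the first one occurring in
   [g_i0] on. The degrees of the iterates of [f] then lie between [theta^r] and a
   constant multiple of it. *)

(** * Weights and leading forms *)

Section Weights.
Context {R : realDomainType} {k : fieldType} {n : nat}.
Implicit Types (w v : 'I_n -> R) (m : multinom n) (p q g h : {mpoly k[n]}).

Definition exp_weight w m : R := \sum_(i < n) (m i)%:R * w i.

Lemma exp_weightD w m1 m2 : exp_weight w (mnm_add m1 m2) = exp_weight w m1 + exp_weight w m2.
Proof.
by rewrite -big_split; apply: eq_bigr => i _; rewrite mnmDE natrD mulrDl.
Qed.

Lemma exp_weight1 w i : exp_weight w (mnm1 i) = w i.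
Proof.
rewrite /exp_weight (bigD1 i) //= mnm1E eqxx mul1r big1 ?addr0 // => j ji.
by rewrite mnm1E eq_sym (negPf ji) mul0r.
Qed.

(** The predicate [A] on weights lets one set of closure lemmas serve homogeneity, strict bounds and
    weak bounds. *)
Definition wsupp w (A : R -> Prop) p := forall m, m \in msupp p -> A (exp_weight w m).

Lemma wsuppW {w} {A B : R -> Prop} {p} :
  wsupp w A p -> (forall x, A x -> B x) -> wsupp w B p.
Proof. by move=> pA AB m /pA /AB. Qed.

Lemma wsupp0 w A : wsupp w A 0.
Proof. by move=> m; rewrite msupp0. Qed.

Lemma wsuppX w (A : R -> Prop) m : A (exp_weight w m) -> wsupp w A (mpolyX k m).
Proof. by move=> Am _ /mem_msuppXP <-. Qed.

Lemma wsuppD w A p q : wsupp w A p -> wsupp w A q -> wsupp w A (p + q).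
Proof. by move=> pA qA m /msuppD_le; rewrite mem_cat => /orP[/pA|/qA]. Qed.

Lemma wsuppZ w A c p : wsupp w A p -> wsupp w A (c *: p).
Proof. by move=> pA m /msuppZ_le /pA. Qed.

Lemma wsupp_sum w A (I : eqType) (r : seq I) (F : I -> {mpoly k[n]}) :
  {in r, forall i, wsupp w A (F i)} -> wsupp w A (\sum_(i <- r) F i).
Proof.
by move=> FA; rewrite big_seq; elim/big_ind: _ => //; [apply: wsupp0|apply: wsuppD].
Qed.

Lemma wsuppM {w} {A B C : R -> Prop} {p q} :
  wsupp w A p -> wsupp w B q -> (forall a b, A a -> B b -> C (a + b)) ->
  wsupp w C (p * q).
Proof.
move=> pA qB ABC m /msuppM_le /allpairsP[[m1 m2] /= [/pA m1A /qB m2B ->]].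
by rewrite exp_weightD; apply: ABC.
Qed.

Definition wbounded w d p := wsupp w (fun x => x <= d) p.

Lemma wbounded1 w : wbounded w 0 1.
Proof.
move=> m; rewrite -mpolyC1 msuppC oner_eq0 inE => /eqP ->.
by rewrite /exp_weight big1 // => i _; rewrite mnm0E mul0r.
Qed.

Lemma wboundedM w d e p q :
  wbounded w d p -> wbounded w e q -> wbounded w (d + e) (p * q).
Proof. by move=> pd qe; apply: (wsuppM pd qe) => a b; apply: lerD. Qed.

Lemma wboundedX w d p j : wbounded w d p -> wbounded w (j%:R * d) (p ^+ j).
Proof.
move=> pd; elim: j => [|j IH]; first by rewrite mul0r; apply: wbounded1.
by rewrite exprS -natr1 addrC mulrDl mul1r; apply: wboundedM.
Qed.

Lemma wbounded_prod {w} {d : 'I_n -> R} {h : 'I_n -> {mpoly k[n]}} m :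
  (forall i, wbounded w (d i) (h i)) ->
  wbounded w (exp_weight d m) (\prod_(i < n) h i ^+ m i).
Proof.
move=> hd; rewrite /exp_weight.
elim/big_ind2: _ => [|x x' y y'|i _]; first exact: wbounded1.
  exact: wboundedM.
exact: wboundedX.
Qed.

Lemma wbounded_comp {w} (d : 'I_n -> R) {e p} {h : n.-tuple {mpoly k[n]}} :
  (forall i, wbounded w (d i) (tnth h i)) -> wbounded d e p ->
  wbounded w e (comp_mpoly h p).
Proof.
move=> hd pe; rewrite comp_mpolyE; apply: wsupp_sum => m /pe me.
by apply: wsuppZ; apply: (wsuppW (wbounded_prod m hd)) => x /le_trans; apply.
Qed.

(* [g] is the homogeneous part of weight [d] of a polynomial [p] of weighted
   degree at most [d]; it vanishes when the degree is smaller. *)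
Definition leading_form w d p g :=
  wsupp w (fun x => x = d) g /\ wsupp w (fun x => x < d) (p - g).

Lemma leading_form_bounded {w d p g} : leading_form w d p g -> wbounded w d p.
Proof.
move=> [gd pg]; rewrite -[p](subrK g).
by apply: wsuppD; [apply: (wsuppW pg) => x /ltW|apply: (wsuppW gd) => x ->].
Qed.

Lemma leading_form_msupp {w d p g m} :
  leading_form w d p g -> m \in msupp g -> m \in msupp p.
Proof.
move=> [gd pg] mg; move: (mg); rewrite !mcoeff_msupp -[p](subrK g) mcoeffD.
have [/pg|/memN_msupp_eq0->] := boolP (m \in msupp (p - g)).
  by rewrite (gd _ mg) ltxx.
by rewrite add0r.
Qed.

Lemma leading_form_top {w d p g m} : leading_form w d p g ->
  m \in msupp p -> exp_weight w m = d -> m \in msupp g.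
Proof.
move=> [_ pg]; rewrite !mcoeff_msupp => pm md; apply: contraNneq pm => gm.
apply/eqP/memN_msupp_eq0/negP => pm.
have : m \in msupp (p - g) by rewrite mcoeff_msupp mcoeffB gm subr0 -mcoeff_msupp.
by move=> /pg; rewrite md ltxx.
Qed.

Lemma leading_form_neq0 {w d p g} : leading_form w d p g -> g != 0 -> p != 0.
Proof.
move=> pg /mlead_supp /(leading_form_msupp pg); apply: contraTneq => ->.
by rewrite msupp0.
Qed.

Lemma leading_form_homogeneous {w d p} :
  wsupp w (fun x => x = d) p -> leading_form w d p p.
Proof. by move=> pd; split=> //; rewrite subrr; apply: wsupp0. Qed.

Lemma leading_form_mvar w i : leading_form w (w i) (mvar k i) (mvar k i).
Proof.
by apply: leading_form_homogeneous; apply: wsuppX; rewrite exp_weight1.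
Qed.

Lemma leading_form_of_bounded w d p :
  wbounded w d p -> exists g, leading_form w d p g.
Proof.
move=> pd; pose part (P : pred (multinom n)) :=
  \sum_(m <- msupp p | P m) mcoeff m p *: mpolyX k m.
have partP (P : pred _) m : m \in msupp (part P) -> (m \in msupp p) && P m.
  move=> /msupp_sum_le /flatten_mapP[m']; rewrite mem_filter => /andP[Pm' pm'].
  by move=> /msuppZ_le /mem_msuppXP <-; rewrite pm'.
exists (part [pred m | exp_weight w m == d]); split=> m.
  by move=> /partP /andP[_ /eqP].
rewrite {1}[p]mpolyE (bigID [pred m | exp_weight w m == d]) /= addrAC subrr add0r.
by move=> /(partP [pred m | exp_weight w m != d]) /andP[/pd md /= neq]; rewrite lt_neqAle neq.
Qed.

Lemma leading_form_exists w p : p != 0 ->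
  exists d g, leading_form w d p g /\ g != 0.
Proof.
move=> p0.
have [m pm mmax] : exists2 m, m \in msupp p &
    {in msupp p, forall m', exp_weight w m' <= exp_weight w m}.
  move: p0; rewrite -msupp_eq0; elim: (msupp p) => // m s IH _.
  have [->|/IH[m' sm' m'max]] := eqVneq s [::].
    by exists m => [|m']; rewrite inE // => /eqP ->.
  have [le|lt] := leP (exp_weight w m) (exp_weight w m').
    exists m' => [|x]; first by rewrite inE sm' orbT.
    by rewrite inE => /predU1P[->|/m'max].
  exists m => [|x]; first exact: mem_head.
  by rewrite inE => /predU1P[->//|/m'max /le_trans]; apply; apply: ltW.
have [g pg] := @leading_form_of_bounded w (exp_weight w m) p mmax.
exists (exp_weight w m), g; split=> //; apply: contraTneq pm => g0.
by have := pg.2 m; rewrite g0 subr0 ltxx => pm; apply/negP => /pm.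
Qed.

Lemma leading_formM w d e p q g h :
  leading_form w d p g -> leading_form w e q h ->
  leading_form w (d + e) (p * q) (g * h).
Proof.
move=> pg qh; have qe := leading_form_bounded qh.
have [[gd pgd] [he qhe]] := (pg, qh); split.
  by apply: (wsuppM gd he) => a b -> ->.
have -> : p * q - g * h = (p - g) * q + g * (q - h).
  by rewrite mulrBl mulrBr addrA subrK.
apply: wsuppD; first by apply: (wsuppM pgd qe) => a b; apply: ltr_leD.
by apply: (wsuppM gd qhe) => a b ->; rewrite ltrD2l.
Qed.

Lemma leading_form1 w : leading_form w 0 1 1.
Proof.
apply: leading_form_homogeneous => m; rewrite -mpolyC1 msuppC oner_eq0 inE.
by move=> /eqP ->; rewrite /exp_weight big1 // => i _; rewrite mnm0E mul0r.
Qed.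

Lemma leading_formX w d p g j :
  leading_form w d p g -> leading_form w (j%:R * d) (p ^+ j) (g ^+ j).
Proof.
move=> pg; elim: j => [|j IH]; first by rewrite mul0r; apply: leading_form1.
by rewrite !exprS -natr1 addrC mulrDl mul1r; apply: leading_formM.
Qed.

Lemma leading_form_prod {w} {d : 'I_n -> R} {h g : 'I_n -> {mpoly k[n]}} m :
  (forall i, leading_form w (d i) (h i) (g i)) ->
  leading_form w (exp_weight d m) (\prod_(i < n) h i ^+ m i) (\prod_(i < n) g i ^+ m i).
Proof.
move=> hg; rewrite /exp_weight.
elim/big_ind3: _ => [|x1 x2 x3 y1 y2 y3|i _]; first exact: leading_form1.
  exact: leading_formM.
exact: leading_formX.
Qed.

(** The degrees [d] of the components are the weights in which [p] is read. Lower terms come from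
    [p - q], and from replacing [h] by [g] in the terms of [q]. Since [comp_mpoly g q] may vanish,
    non-cancellation needs a separate dominance argument. *)
Lemma leading_form_comp {w} (d : 'I_n -> R) {e p q} {h g : n.-tuple {mpoly k[n]}} :
  (forall i, leading_form w (d i) (tnth h i) (tnth g i)) ->
  leading_form d e p q ->
  leading_form w e (comp_mpoly h p) (comp_mpoly g q).
Proof.
move=> hg [qe pqe].
have mono m := leading_form_prod m hg.
split.
  rewrite comp_mpolyE; apply: wsupp_sum => m /qe <-.
  by apply: wsuppZ; have [] := mono m.
have -> : comp_mpoly h p - comp_mpoly g q =
    comp_mpoly h (p - q) + (comp_mpoly h q - comp_mpoly g q).
  by rewrite raddfB addrA subrK.
apply: wsuppD.
  rewrite comp_mpolyE; apply: wsupp_sum => m /pqe lt_me.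
  apply: wsuppZ; apply: (wsuppW (leading_form_bounded (mono m))) => x.
  by move/le_lt_trans; apply.
rewrite !comp_mpolyE -sumrB; apply: wsupp_sum => m /qe <-.
by rewrite -scalerBr; apply: wsuppZ; have [] := mono m.
Qed.

End Weights.

(** * Composition *)

(** In an iteration the inner components have degrees [t ^+ r * w i], so the outer ones must be read
    in the weight rescaled by [t ^+ r]. *)
Lemma leading_form_scale {R : realDomainType} {k : fieldType} {n}
    {w : 'I_n -> R} {d : R} {p g : {mpoly k[n]}} {c : R} : 0 < c ->
  leading_form w d p g -> leading_form (fun i => c * w i) (c * d) p g.
Proof.
move=> c0 [gd pg].
have E m : exp_weight (fun i => c * w i) m = c * exp_weight w m.
  by rewrite mulr_sumr; apply: eq_bigr => i _; rewrite mulrCA.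
by split=> m; rewrite E; [move=> /gd ->|rewrite ltr_pM2l //; apply: pg].
Qed.

Section Composition.
Context {k : fieldType} {n : nat}.
Implicit Types (f g : n.-tuple {mpoly k[n]}) (p : {mpoly k[n]}).

Lemma comp_mpoly_mvar f i : comp_mpoly f (mvar k i) = tnth f i.
Proof. by rewrite comp_mpolyXU -tnth_nth. Qed.

Lemma tnth_endo_comp f g i : tnth (endo_comp f g) i = comp_mpoly g (tnth f i).
Proof. by rewrite tnth_mktuple. Qed.

Lemma comp_mpoly_comp f g p :
  comp_mpoly g (comp_mpoly f p) = comp_mpoly (endo_comp f g) p.
Proof.
rewrite [comp_mpoly f p]comp_mpolyE raddf_sum comp_mpolyE /=.
apply: eq_bigr => m _; rewrite comp_mpolyZ rmorph_prod; congr (_ *: _).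
by apply: eq_bigr => i _; rewrite rmorphXn tnth_endo_comp.
Qed.

Lemma comp_mpoly_endo_id p : comp_mpoly (endo_id k n) p = p.
Proof. exact: comp_mpoly_id. Qed.

Lemma endo_iterS f r : endo_iter f r.+1 = endo_comp f (endo_iter f r).
Proof. by []. Qed.

(** Iterates are built by composing with [f] on the outside, whereas the dominance argument
    substitutes [f] into an iterate. *)
Lemma endo_iterSr f r : endo_iter f r.+1 = endo_comp (endo_iter f r) f.
Proof.
elim: r => [|r IH]; apply: eq_from_tnth => i.
  rewrite endo_iterS !tnth_endo_comp comp_mpoly_endo_id tnth_mktuple.
  by rewrite comp_mpoly_mvar.
by rewrite [in LHS]endo_iterS {1}IH [in RHS]endo_iterS !tnth_endo_comp comp_mpoly_comp.
Qed.

Lemma leading_form_iter {R : realDomainType} {w : 'I_n -> R} {t : R} {f g} :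
  0 < t -> (forall i, leading_form w (t * w i) (tnth f i) (tnth g i)) ->
  forall r i,
    leading_form w (t ^+ r * w i) (tnth (endo_iter f r) i) (tnth (endo_iter g r) i).
Proof.
move=> t0 fg; elim=> [|r IH] i.
  by rewrite mul1r !tnth_mktuple; apply: leading_form_mvar.
rewrite 2!endo_iterS [X in leading_form _ _ X _]tnth_endo_comp tnth_endo_comp.
rewrite exprSr -mulrA; apply: (leading_form_comp _ IH).
by apply: leading_form_scale (fg i); apply: exprn_gt0.
Qed.

Lemma comp_mpoly_perm_neq0 (s : 'I_n -> 'I_n) p : injective s ->
  p != 0 -> comp_mpoly [tuple mvar k (s i) | i < n] p != 0.
Proof.
move=> s_inj; apply: contraNneq => ps0.
rewrite -[p]comp_mpoly_endo_id.
have -> : endo_id k n =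
    endo_comp [tuple mvar k (s i) | i < n] [tuple mvar k (finv s i) | i < n].
  apply: eq_from_tnth => i.
  by rewrite tnth_endo_comp !tnth_mktuple comp_mpoly_mvar tnth_mktuple finv_f.
by rewrite -comp_mpoly_comp ps0 raddf0.
Qed.

Definition vars_in (S : {set 'I_n}) p :=
  forall m, m \in msupp p -> forall i, i \notin S -> m i = 0%N.

(** * Substitutions that kill no nonzero polynomial in the variables of [S] *)

Section Dominance.
Variables (s : 'I_n -> 'I_n) (i0 v : 'I_n) (S : {set 'I_n}) (g : n.-tuple {mpoly k[n]}).
Hypothesis s_inj : injective s.
Hypothesis g_shift : forall i, i != i0 -> tnth g i = mvar k (s i).
Hypothesis sS : forall i, i \in S -> i != i0 -> s i \in S :\ v.
Hypothesis g0S : vars_in S (tnth g i0).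
Hypothesis g0v : exists2 m : multinom n, m \in msupp (tnth g i0) & m v != 0%N.

Lemma vars_in_comp p : vars_in S p -> vars_in S (comp_mpoly g p).
Proof.
(* With weight 1 off [S] and 0 on [S], involving only variables of [S] means having degree at most
   0. *)
pose w i : rat := (i \notin S)%:R.
have vars_inE q : vars_in S q <-> wbounded w 0 q.
  split=> [qS m qm|q0 m qm i iS].
    rewrite /exp_weight big1 // => i _; rewrite /w.
    by case: (boolP (i \in S)) => [|/(qS m qm)->]; rewrite ?mulr0 ?mul0r.
  have: (m i)%:R <= 0 :> rat.
    apply: le_trans (q0 m qm); rewrite /exp_weight (bigD1 i) //= /w iS mulr1.
    by rewrite lerDl sumr_ge0 // => j _; rewrite mulr_ge0 ?ler0n.
  by rewrite lern0 => /eqP.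
pose d i := if i == i0 then 0 else w (s i).
have gd i : wbounded w (d i) (tnth g i).
  rewrite /d; have [->|ii0] := eqVneq i i0; first exact/vars_inE.
  by rewrite g_shift //; apply: leading_form_bounded (leading_form_mvar _ _).
move=> pS; apply/vars_inE/(wbounded_comp d gd) => m pm.
rewrite /exp_weight big1 // => i _; rewrite /d.
have [->|ii0] := eqVneq i i0; first by rewrite mulr0.
case: (boolP (i \in S)) => [iS|/(pS m pm)->]; last by rewrite mul0r.
by rewrite /w; have := sS _ iS ii0; rewrite inE => /andP[_ ->]; rewrite mulr0.
Qed.

(** Compare degrees in the variable [v]. Among the components of index in [S], only that of index
    [i0] involves [v], so the top part of the composite comes from the part of [p] of top degree in
    the variable [i0]. Up to powers of [q] and of one variable, this part is only renamed. *)
Lemma comp_neq0 p : p != 0 -> vars_in S p -> comp_mpoly g p != 0.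
Proof.
move=> p0 pS.
pose w i : rat := (i == v)%:R.
have g00 : tnth g i0 != 0.
  by have [m gm _] := g0v; apply: contraTneq gm => ->; rewrite msupp0.
have [e [q [gq q0]]] := leading_form_exists w _ g00.
have weE m : exp_weight w m = (m v)%:R.
  rewrite /exp_weight (bigD1 v) //= /w eqxx mulr1 big1 ?addr0 // => i /negPf ->.
  by rewrite mulr0.
have e0 : 0 < e.
  have [m gm mv] := g0v.
  have : exp_weight w m <= e by apply: leading_form_bounded gq m gm.
  by apply: lt_le_trans; rewrite weE ltr0n lt0n.
(* The degrees in [v] of the components of [g], used as weights for [p]. *)
pose d i := if i == i0 then e else w (s i).
have [D [p1 [pp1 p10]]] := leading_form_exists d _ p0.
pose h := [tuple if i == i0 then q else mvar k (s i) | i < n].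
have gh i : leading_form w (d i) (tnth g i) (tnth h i).
  rewrite tnth_mktuple /d; have [->//|ii0] := eqVneq i i0.
  by rewrite g_shift //; apply: leading_form_mvar.
suff ph0 : comp_mpoly h p1 != 0.
  exact: leading_form_neq0 (leading_form_comp d gh pp1) ph0.
(* [p1] is homogeneous in the variable of index [i0]. *)
have pD m : m \in msupp p1 -> (m i0)%:R * e = D.
  move=> p1m; rewrite -(pp1.1 _ p1m) /exp_weight (bigD1 i0) //= /d eqxx big1 ?addr0 //.
  move=> i ii0; rewrite (negPf ii0) /w.
  case: (boolP (i \in S)) => [iS|]; last first.
    by move/(pS m (leading_form_msupp pp1 p1m)) ->; rewrite mul0r.
  by have := sS _ iS ii0; rewrite !inE => /andP[/negPf -> _]; rewrite mulr0.
have [m0 p1m0] : exists m, m \in msupp p1.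
  by exists (mlead p1); apply: mlead_supp.
have pj m : m \in msupp p1 -> m i0 = m0 i0.
  move=> p1m; apply/eqP; rewrite -(@eqr_nat rat); apply/eqP.
  by apply: (mulIf (lt0r_neq0 e0)); rewrite !pD.
pose x := [tuple mvar k (s i) | i < n].
(* As [m i0] is constant on [p1], the power of [q] factors out; trading it for a power of the
   variable [s i0] leaves the injective renaming [x]. *)
have E : comp_mpoly h p1 * mvar k (s i0) ^+ m0 i0 = q ^+ m0 i0 * comp_mpoly x p1.
  rewrite !comp_mpolyE mulr_suml mulr_sumr; apply: eq_big_seq => m p1m.
  rewrite -scalerAl -scalerAr; congr (_ *: _).
  rewrite (bigD1 i0) //= [in RHS](bigD1 i0) //= !tnth_mktuple eqxx (pj _ p1m) mulrAC mulrA.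
  rewrite -!mulrA; congr (_ * (_ * _)); apply: eq_bigr => i /negPf ii0.
  by rewrite !tnth_mktuple ii0.
apply: contraTneq (comp_mpoly_perm_neq0 s _ s_inj p10) => ph0.
move/eqP: E; rewrite ph0 mul0r eq_sym mulf_eq0 => /orP[|/eqP ->]; last by rewrite eqxx.
by rewrite expf_eq0 (negPf q0) andbF.
Qed.

End Dominance.
End Composition.

(** * Weighted and ordinary degrees of endomorphisms *)

Section Degrees.
Context {R : realType} {k : fieldType} {n : nat}.
Implicit Types (mu : 'rV[R]_n) (p : {mpoly k[n]}) (h : n.-tuple {mpoly k[n]}).

Lemma wdeg_leP {mu p d} : (wdeg mu p <= d%:E)%E <-> wbounded (mu 0) d p.
Proof.
split=> [le_d m pm|pd].
  rewrite -lee_fin; apply: le_trans le_d.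
  exact: (@le_bigmax_seq _ _ _ _ -oo%E m xpredT
    (fun m : multinom n => (\sum_(i < n) (m i)%:R * mu 0 i)%:E)).
rewrite /wdeg big_seq; elim/big_ind: _ => [|x y xd yd|m pm]; first exact: leNye.
  by rewrite ge_max xd.
by rewrite lee_fin; apply: pd.
Qed.

Lemma wdeg_eq mu p d m :
  wbounded (mu 0) d p -> m \in msupp p -> exp_weight (mu 0) m = d ->
  wdeg mu p = d%:E.
Proof.
move=> pd pm md; apply/eqP; rewrite eq_le; apply/andP; split; first exact/wdeg_leP.
rewrite -md; exact: (@le_bigmax_seq _ _ _ _ -oo%E m xpredT
  (fun m : multinom n => (\sum_(i < n) (m i)%:R * mu 0 i)%:E)).
Qed.

(** One monomial reaching the bound at an index of positive weight forces every admissible factor to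
    be at least [t]. *)
Lemma endo_wdeg_eq mu h t i m : 0 <= t ->
  (forall j, wbounded (mu 0) (t * mu 0 j) (tnth h j)) ->
  m \in msupp (tnth h i) -> exp_weight (mu 0) m = t * mu 0 i -> 0 < mu 0 i ->
  endo_wdeg mu h = t%:E.
Proof.
move=> t0 ht hm mt mu_i; apply/eqP; rewrite eq_le; apply/andP; split.
  apply: ge_ereal_inf; exists t%:E => //; exists t => //; split=> // j.
  exact/wdeg_leP.
apply/ereal_infP => _ [u [u0 hu] <-]; rewrite lee_fin -(ler_pM2r mu_i) -mt.
exact: (wdeg_leP.1 (hu i)).
Qed.

Lemma exp_weight_mdeg m : exp_weight (fun _ : 'I_n => 1 : R) m = (mdeg m)%:R.
Proof. by rewrite mdegE natr_sum; apply: eq_bigr => i _; rewrite mulr1. Qed.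

Lemma endo_deg_le h (x : R) : 0 <= x ->
  (forall i, wbounded (fun _ => 1) x (tnth h i)) -> (endo_deg h)%:R <= x.
Proof.
move=> x0 hx; rewrite /endo_deg; elim/big_ind: _ => // [a b ax bx|i _].
  by rewrite /maxn; case: ifP.
have [->|p0] := eqVneq (tnth h i) 0; first by rewrite mmeasure0.
have /(hx i) := mlead_supp p0; rewrite exp_weight_mdeg.
by rewrite -(mlead_deg p0).
Qed.

Lemma mdeg_le_endo_deg h i m : m \in msupp (tnth h i) -> (mdeg m <= endo_deg h)%N.
Proof.
move=> hm; apply: leq_trans (leq_bigmax (F := fun i => (mmeasure (@mdeg n) (tnth h i)).-1) i).
by have := mmeasure_mnm_lt (@mdeg n) hm; case: mmeasure.
Qed.

End Degrees.

Lemma root_cvg_of_geometric {R : realType} {u : nat -> nat} {t A : R} :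
  0 < t -> 0 < A -> (forall r, t ^+ r <= (u r)%:R <= A * t ^+ r) ->
  ((fun r => (u r)%:R `^ (r%:R^-1)) @ \oo --> t)%classic.
Proof.
(* The term of index 0, whose exponent is the inverse of 0, is dropped; then the roots are squeezed,
   since the [r]-th root of [A] tends to 1. *)
move=> t0 A0 ut; rewrite -cvg_shiftS /=.
have root_t (r : nat) : (t ^+ r.+1) `^ (r.+1%:R^-1) = t.
  by rewrite -powR_mulrn ?(ltW t0) // -powRrM mulfV ?powRr1 ?(ltW t0) // pnatr_eq0.
apply: (@squeeze_cvgr _ _ _ _ (fun=> t) (fun r => A `^ (harmonic r) * t)).
- apply: nearW => r; have /andP[lt_u lt_A] := ut r.+1.
  have u0 : 0 <= (u r.+1)%:R :> R by [].
  have tr0 : 0 <= t ^+ r.+1 by rewrite exprn_ge0 // ltW.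
  have r0 : 0 <= r.+1%:R^-1 :> R by rewrite invr_ge0.
  rewrite -{1}(root_t r) ge0_ler_powR //=.
  apply: le_trans (ge0_ler_powR r0 _ _ lt_A) _; rewrite ?nnegrE ?mulr_ge0 ?(ltW A0) //.
  by rewrite powRM ?(ltW A0) // root_t.
- exact: cvg_cst.
have root_A : ((fun r => A `^ (harmonic r)) @ \oo --> (1 : R))%classic.
  under eq_fun do rewrite /powR gt_eqF //.
  rewrite -expR0 -(mul0r (ln A)).
  apply: (@cvg_comp _ _ _ (fun r => harmonic r * ln A) expR); last exact: continuous_expR.
  by apply: cvgM; [exact: cvg_harmonic|exact: cvg_cst].
have : ((fun r => A `^ (harmonic r) * t) @ \oo --> 1 * t)%classic.
  by apply: cvgM => //; exact: cvg_cst.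
by rewrite mul1r.
Qed.

(** * The cycle through the exceptional index *)

Lemma char_poly_tr {A : comNzRingType} {n} (M : 'M[A]_n) :
  char_poly M^T = char_poly M.
Proof.
by rewrite /char_poly /char_poly_mx -det_tr raddfB /= tr_scalar_mx -map_trmx trmxK.
Qed.

Section Cycle.
Context {n : nat} {s : 'I_n -> 'I_n} (s_inj : injective s) {i0 : 'I_n}.

(** The cycle is read from [s i0], so that [i0] comes last and the index grows by one at every step
    of [s] from another point. *)
Definition on_cycle i := fconnect s (s i0) i.
Definition cycle_index i := findex s (s i0) i.
Definition cycle_length := fingraph.order s (s i0).

(** The solution of [u (s i) = t * u i] for [i != i0] that is 1 at [s i0] and 0 off the cycle: the
    candidate eigenvector. *)
Definition cycle_pow (A : pzSemiRingType) (t : A) i : A :=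
  if on_cycle i then t ^+ cycle_index i else 0.
Local Arguments cycle_pow {A} t i.

Lemma cycle_length_gt0 : (0 < cycle_length)%N.
Proof. exact: order_gt0. Qed.

Lemma iter_cycle_last : iter cycle_length.-1 s (s i0) = i0.
Proof.
apply: s_inj; rewrite -iterS prednK ?cycle_length_gt0 //.
exact: iter_order.
Qed.

Lemma on_cycle_last : on_cycle i0.
Proof. by rewrite /on_cycle -[X in fconnect _ _ X]iter_cycle_last fconnect_iter. Qed.

Lemma cycle_index_last : cycle_index i0 = cycle_length.-1.
Proof.
rewrite /cycle_index -[X in findex _ _ X]iter_cycle_last findex_iter //.
by rewrite prednK ?cycle_length_gt0.
Qed.

Lemma cycle_index_lt {i} : on_cycle i -> (cycle_index i < cycle_length)%N.
Proof. exact: findex_max. Qed.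

Lemma on_cycle_succ i : on_cycle (s i) = on_cycle i.
Proof. by rewrite /on_cycle -(same_fconnect1_r s_inj). Qed.

Lemma cycle_index_succ {i} : on_cycle i -> i != i0 ->
  cycle_index (s i) = (cycle_index i).+1.
Proof.
move=> ci ii0; have lt := cycle_index_lt ci.
have Ei : iter (cycle_index i) s (s i0) = i by apply: iter_findex.
rewrite -[X in cycle_index (s X)]Ei -iterS /cycle_index findex_iter //.
rewrite -/cycle_length ltn_neqAle lt andbT; apply: contraNneq ii0 => jl.
by rewrite -Ei -[X in _ == X]iter_cycle_last -jl.
Qed.

Section Powers.
Variables (A : pzSemiRingType) (t : A).

Lemma cycle_pow_succ i : i != i0 -> cycle_pow t (s i) = t * cycle_pow t i.
Proof.
move=> ii0; rewrite /cycle_pow on_cycle_succ.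
case: ifP => [ci|_]; last by rewrite mulr0.
by rewrite cycle_index_succ // exprS.
Qed.

Lemma cycle_pow_last : t * cycle_pow t i0 = t ^+ cycle_length.
Proof.
rewrite /cycle_pow on_cycle_last cycle_index_last -exprS prednK //.
exact: cycle_length_gt0.
Qed.

End Powers.

(** * Eigenvalues of a matrix that is a shift outside row [i0] *)

Section Eigenvalues.
Context {F : fieldType} {M : 'M[nat]_n} (t : F).
Hypothesis M_shift : forall i j, i != i0 -> M i j = (s i == j).
Local Notation MF := (map_mx (fun m : nat => m%:R : F) M).

Lemma row_shift (u : 'I_n -> F) i : i != i0 -> \sum_j (M i j)%:R * u j = u (s i).
Proof.
move=> ii0; rewrite (bigD1 (s i)) //= M_shift // eqxx mul1r big1 ?addr0 // => j.
by rewrite M_shift // eq_sym => /negPf ->; rewrite mul0r.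
Qed.

(** [eigenvalue] refers to row vectors acting on the left, whereas the shift condition on rows is
    suited to right eigenvectors; transposition relates the two. *)
Lemma eigenvalue_right :
  eigenvalue MF t <-> exists u : 'I_n -> F,
    (forall i, \sum_j (M i j)%:R * u j = t * u i) /\ exists i, u i != 0.
Proof.
rewrite eigenvalue_root_char -char_poly_tr -eigenvalue_root_char; split.
  move=> /eigenvalueP[u uM u0]; exists (u 0); split=> [i|].
    have /rowP/(_ i) := uM; rewrite !mxE => <-.
    by apply: eq_bigr => j _; rewrite !mxE mulrC.
  apply/existsP; apply: contra_neqT u0 => /existsPn u0; apply/rowP => i.
  by rewrite mxE; apply/eqP/negPn.
move=> [u [uM [i ui]]]; apply/eigenvalueP; exists (\row_i u i).
  apply/rowP => j; rewrite !mxE -uM.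
  by apply: eq_bigr => l _; rewrite !mxE mulrC.
by apply: contraNneq ui => /rowP/(_ i); rewrite !mxE => ->.
Qed.

(** [cycle_pow t] is a right eigenvector: the shift gives all rows but [i0], and the assumed
    equation is row [i0]. *)
Lemma eigenvalue_of_cycle_equation :
  t ^+ cycle_length = \sum_j (M i0 j)%:R * cycle_pow t j -> eigenvalue MF t.
Proof.
move=> eq_t; apply/eigenvalue_right; exists (cycle_pow t); split.
  move=> i; have [->|ii0] := eqVneq i i0; first by rewrite cycle_pow_last.
  by rewrite row_shift // cycle_pow_succ.
exists (s i0); rewrite /cycle_pow /on_cycle connect0 /cycle_index findex0.
exact: oner_neq0.
Qed.

(* Off the cycle, a full turn around an orbit of length [c] multiplies an eigenvector
   by [t^c], so it vanishes there when [t] is not a root of unity. *)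
Lemma cycle_equation_of_eigenvalue :
  (forall j, (0 < j)%N -> t ^+ j != 1) -> eigenvalue MF t ->
  t ^+ cycle_length = \sum_j (M i0 j)%:R * cycle_pow t j.
Proof.
move=> t_nroot /eigenvalue_right[u [uM [i1 ui1]]].
have u_succ i : i != i0 -> u (s i) = t * u i by move=> ?; rewrite -uM row_shift.
have off i : ~~ on_cycle i -> u i = 0.
  move=> ci; have iterE j : u (iter j s i) = t ^+ j * u i.
    elim: j => [|j IH]; first by rewrite mul1r.
    rewrite iterS u_succ ?IH ?exprS ?mulrA //; apply: contraNneq ci => ji.
    by rewrite /on_cycle fconnect_sym // -ji -iterS fconnect_iter.
  have := iterE (fingraph.order s i); rewrite iter_order // => /eqP.
  rewrite -subr_eq0 -{1}[u i]mul1r -mulrBl mulf_eq0 subr_eq0 eq_sym.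
  by rewrite (negPf (t_nroot _ (order_gt0 _ _))) => /eqP.
(* The eigenvector is determined by its value at [s i0], which is therefore nonzero and can be
   cancelled from row [i0]. *)
have uE i : u i = cycle_pow t i * u (s i0).
  rewrite /cycle_pow; case: ifPn => [ci|/off->]; last by rewrite mul0r.
  rewrite -[in LHS](iter_findex ci) -/(cycle_index i).
  elim: (cycle_index i) (cycle_index_lt ci) => [|j IH] lt; first by rewrite mul1r.
  rewrite iterS u_succ ?IH ?exprS ?mulrA ?(ltnW lt) //.
  apply: (contraTneq _ lt) => ji.
  have := cycle_index_last; rewrite -ji /cycle_index findex_iter; last exact: ltnW lt.
  by move=> ->; rewrite prednK ?cycle_length_gt0 // ltnn.
have uL : u (s i0) != 0.
  by apply: contraNneq ui1 => u0; rewrite uE u0 mulr0.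
apply: (mulIf uL); rewrite -cycle_pow_last -mulrA -uE -uM mulr_suml.
by apply: eq_bigr => j _; rewrite uE mulrA.
Qed.

End Eigenvalues.
End Cycle.

Arguments on_cycle {n} s i0 i.
Arguments cycle_index {n} s i0 i.
Arguments cycle_length {n} s i0.
Arguments cycle_pow {n} s i0 {A} t i.

Lemma cycle_pow_rmorph {A B : pzSemiRingType} (phi : {rmorphism A -> B}) {n}
    (s : 'I_n -> 'I_n) i0 (t : A) i :
  phi (cycle_pow s i0 t i) = cycle_pow s i0 (phi t) i.
Proof. by rewrite /cycle_pow; case: ifP => _; rewrite ?rmorph0 ?rmorphXn. Qed.

Lemma cycle_pow_ge0 {A : numDomainType} {n} (s : 'I_n -> 'I_n) i0 (t : A) i :
  0 <= t -> 0 <= cycle_pow s i0 t i.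
Proof. by move=> t0; rewrite /cycle_pow; case: ifP => // _; apply: exprn_ge0. Qed.

(** Off the orbit, [findex] returns its default, the orbit size, which exceeds every index on the
    cycle. *)
Lemma cycle_index_off {n} {s : 'I_n -> 'I_n} {i0 i} :
  ~~ on_cycle s i0 i -> cycle_index s i0 i = cycle_length s i0.
Proof.
rewrite /on_cycle fconnect_orbit /cycle_index /findex => /memNindex ->.
exact: size_orbit.
Qed.

(** * The maximal eigenvalue *)

(** The factor that the cycle contributes to the characteristic polynomial of a contained matrix
    with row [m] at [i0]. The ring is arbitrary so that it can be taken over the integers and over
    the reals. *)
Definition cycle_poly {A : nzRingType} {n} (s : 'I_n -> 'I_n) i0 (m : multinom n) :
    {poly A} :=
  'X^(cycle_length s i0) - \sum_j (m j)%:R * cycle_pow s i0 'X j.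

Lemma map_cycle_poly {A B : nzRingType} (phi : {rmorphism A -> B}) {n}
    (s : 'I_n -> 'I_n) i0 m :
  map_poly phi (cycle_poly s i0 m) = cycle_poly s i0 m.
Proof.
rewrite /cycle_poly rmorphB rmorph_sum /= rmorphXn /= map_polyX; congr (_ - _).
by apply: eq_bigr => j _; rewrite rmorphM rmorph_nat /= cycle_pow_rmorph /= map_polyX.
Qed.

Lemma horner_cycle_poly {R : realDomainType} {n} (s : 'I_n -> 'I_n) i0 m (t : R) :
  (cycle_poly s i0 m).[t] = t ^+ cycle_length s i0 - exp_weight (cycle_pow s i0 t) m.
Proof.
rewrite -[LHS]/(horner_eval t (cycle_poly s i0 m)) rmorphB rmorph_sum rmorphXn /=.
rewrite /horner_eval hornerX; congr (_ - _); apply: eq_bigr => j _.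
rewrite -[LHS]/(horner_eval t _) rmorphM rmorph_nat /= cycle_pow_rmorph /=.
by rewrite /horner_eval hornerX.
Qed.

Lemma coef_cycle_poly {A : nzRingType} {n} (s : 'I_n -> 'I_n) i0 m l :
  (cycle_poly s i0 m)`_l = (l == cycle_length s i0)%:R -
     (\sum_(j | on_cycle s i0 j && (cycle_index s i0 j == l)) m j)%:R :> A.
Proof.
rewrite /cycle_poly coefB coefXn coef_sum; congr (_ - _).
rewrite natr_sum [RHS]big_mkcond; apply: eq_bigr => j _.
rewrite mulr_natl coefMn /cycle_pow; case: ifP => _ /=; last by rewrite coef0 mul0rn.
by rewrite coefXn eq_sym; case: eqP => _; rewrite ?mul0rn.
Qed.

Lemma size_cycle_poly {A : nzRingType} {n} (s : 'I_n -> 'I_n) i0 m :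
  size (cycle_poly s i0 m : {poly A}) = (cycle_length s i0).+1.
Proof.
apply/eqP; rewrite eqn_leq; apply/andP; split.
  apply/leq_sizeP => l ltl; rewrite coef_cycle_poly gtn_eqF // big_pred0 ?subrr // => j.
  by apply/andP => -[cj /eqP jl]; have := cycle_index_lt cj; rewrite jl ltnNge ltnW.
rewrite ltnNge; apply/negP => /leq_sizeP/(_ _ (leqnn _)) /eqP.
rewrite coef_cycle_poly eqxx big_pred0 ?subr0 ?oner_eq0 // => j.
by apply/andP => -[cj /eqP jl]; have := cycle_index_lt cj; rewrite jl ltnn.
Qed.

Lemma cycle_poly_monic {A : nzRingType} {n} (s : 'I_n -> 'I_n) i0 m :
  (cycle_poly s i0 m : {poly A}) \is monic.
Proof.
rewrite monicE lead_coefE size_cycle_poly /= coef_cycle_poly eqxx big_pred0 ?subr0 //.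
move=> j; apply/andP => -[cj /eqP jl].
by have := cycle_index_lt cj; rewrite jl ltnn.
Qed.

(** The equation says that [t] is a root of [cycle_poly], whose coefficients below the leading one
    are minus sums of exponents of [m]. *)
Lemma Handelman_of_cycle_equation {R : realType} {n} {s : 'I_n -> 'I_n} {i0 m} {t : R} :
  0 < t -> exp_weight (cycle_pow s i0 t) m = t ^+ cycle_length s i0 -> is_Handelman t.
Proof.
move=> t0 eq_t; split=> //; exists (cycle_poly s i0 m); split.
- exact: cycle_poly_monic.
- move=> l; rewrite size_cycle_poly /= => lt.
  by rewrite coef_cycle_poly ltn_eqF // sub0r oppr_le0 ler0n.
by rewrite map_cycle_poly rootE horner_cycle_poly eq_t subrr.
Qed.

Section MaximalEigenvalue.
Context {R : realType} {k : fieldType} {n : nat} {s : 'I_n -> 'I_n} {i0 : 'I_n}.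
Context {f : n.-tuple {mpoly k[n]}}.
Hypothesis s_inj : injective s.
Hypothesis f_shift : forall i, i != i0 -> tnth f i = mvar k (s i).

Lemma contained_shift {M} i j : is_contained M f -> i != i0 -> M i j = (s i == j).
Proof.
move=> fM ii0; have := fM i; rewrite f_shift // mcoeffX.
have [E _|_] := eqVneq (mnm1 (s i)); last by rewrite eqxx.
by have /mnmP/(_ j) := E; rewrite mnm1E mnmE => <-.
Qed.

Lemma modulus_of_cycle_equation m (t : R) :
  m \in msupp (tnth f i0) -> 0 < t ->
  exp_weight (cycle_pow s i0 t) m = t ^+ cycle_length s i0 ->
  eigenvalue_moduli f t.
Proof.
move=> fm t0 eq_t.
(* The contained matrix selecting [m] in row [i0]; the other rows are forced. *)
pose M : 'M[nat]_n := \matrix_(i, j) if i == i0 then m j else (s i == j) : nat.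
have Mm j : M i0 j = m j by rewrite mxE eqxx.
have fM : is_contained M f.
  move=> i; rewrite -mcoeff_msupp; have [->|ii0] := eqVneq i i0.
    suff -> : Multinom [tuple M i0 j | j < n] = m by [].
    by apply/mnmP => j; rewrite mnmE Mm.
  rewrite f_shift // msuppX inE; apply/eqP/mnmP => j.
  by rewrite mnmE mnm1E mxE (negPf ii0).
exists M, (t%:C)%C; split=> //; last by rewrite ger0_norm // ler0c ltW.
apply: (@eigenvalue_of_cycle_equation _ s s_inj i0).
  by move=> i j; apply: contained_shift.
rewrite -rmorphXn -eq_t rmorph_sum /=; apply: eq_bigr => j _.
by rewrite Mm rmorphM rmorph_nat /= cycle_pow_rmorph.
Qed.

Context {theta : R}.
Hypothesis theta_max : is_maximal_eigenvalue f theta.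
Hypothesis theta_gt1 : 1 < theta.
Local Notation l := (cycle_length s i0).
Local Notation w := (cycle_pow s i0 theta).

Let theta_gt0 : 0 < theta. Proof. exact: lt_trans theta_gt1. Qed.

(** Otherwise [cycle_poly] is negative at [theta], hence has a real root beyond it, which is an
    eigenvalue modulus, against maximality. *)
Lemma exp_weight_le m : m \in msupp (tnth f i0) -> exp_weight w m <= theta ^+ l.
Proof.
move=> fm; rewrite leNgt; apply/negP => lt_theta.
pose q : {poly R} := cycle_poly s i0 m.
have q_theta : q.[theta] < 0 by rewrite horner_cycle_poly subr_lt0.
(* Large enough for the leading term to dominate: the lower terms at [b] are at most [b ^+ l.-1]
   times the sum of the exponents. *)
pose b := theta + (\sum_j m j)%:R.
have le_b : theta <= b by rewrite lerDl ler0n.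
have b1 : 1 <= b by rewrite (le_trans (ltW theta_gt1)).
have q_b : 0 <= q.[b].
  rewrite horner_cycle_poly subr_ge0.
  have /le_trans : exp_weight (cycle_pow s i0 b) m <= b ^+ l.-1 * (\sum_j m j)%:R.
    rewrite natr_sum mulr_sumr; apply: ler_sum => j _; rewrite mulrC.
    apply: ler_wpM2r; first exact: ler0n.
    rewrite /cycle_pow; case: ifP => [cj|_]; last by rewrite exprn_ge0 // (le_trans ler01).
    by apply: ler_weXn2l => //; rewrite -ltnS prednK ?cycle_length_gt0 ?cycle_index_lt.
  have -> : b ^+ l = b ^+ l.-1 * b by rewrite -exprSr prednK ?cycle_length_gt0.
  by apply; rewrite ler_wpM2l ?exprn_ge0 ?(le_trans ler01 b1) // lerDr ltW.
have [x /andP[theta_x xb] /rootP qx] := poly_ivt le_b (introT andP (conj (ltW q_theta) q_b)).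
have x0 := lt_le_trans theta_gt0 theta_x.
have : exp_weight (cycle_pow s i0 x) m = x ^+ l.
  by apply/eqP; rewrite eq_sym -subr_eq0 -horner_cycle_poly qx.
move=> /(modulus_of_cycle_equation m x fm x0) /theta_max.2 x_theta.
have xE : x = theta by apply/eqP; rewrite eq_le x_theta.
by move: q_theta; rewrite -xE qx ltxx.
Qed.

(** Take the row [i0] of a matrix with an eigenvalue of modulus [theta]. As [theta > 1], it is no
    root of unity, so the cycle equation holds; the triangle inequality gives the missing bound. *)
Lemma exp_weight_attained :
  exists2 m, m \in msupp (tnth f i0) & exp_weight w m = theta ^+ l.
Proof.
have [M [xi [fM M_xi xi_theta]]] := theta_max.1.
pose m := Multinom [tuple M i0 j | j < n].
have fm : m \in msupp (tnth f i0) by rewrite mcoeff_msupp; apply: fM.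
exists m => //; apply/eqP; rewrite eq_le exp_weight_le //=.
have : xi ^+ l = \sum_j (M i0 j)%:R * cycle_pow s i0 xi j.
  apply: (cycle_equation_of_eigenvalue s_inj _ _ _ M_xi) => [i j|j j0].
    exact: contained_shift.
  apply: contraTneq theta_gt1 => /(congr1 Num.norm).
  rewrite normrX xi_theta normr1 -rmorphXn => /eqP.
  rewrite -(rmorph1 (real_complex R)).
  rewrite (inj_eq (@complexI R)) => /eqP theta_j.
  by rewrite -(expr_gt1 j0 (ltW theta_gt0)) theta_j ltxx.
move=> /(congr1 Num.norm); rewrite normrX xi_theta => eq_theta.
rewrite -lecR rmorphXn /= eq_theta (le_trans (ler_norm_sum _ _ _)) //.
rewrite rmorph_sum /=; apply: ler_sum => j _.
rewrite mnmE rmorphM rmorph_nat normrM normr_nat /= cycle_pow_rmorph /= -xi_theta.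
by rewrite /cycle_pow; case: ifP => _; rewrite ?normrX ?normr0.
Qed.

Lemma maximal_eigenvalue_Handelman : is_Handelman theta.
Proof.
by have [m _ /(Handelman_of_cycle_equation theta_gt0)] := exp_weight_attained.
Qed.

(** * The maximal eigenvector, the leading endomorphism and the growth of iterates *)

Lemma cycle_weight_last_gt0 : 0 < w i0.
Proof. by rewrite /cycle_pow on_cycle_last // exprn_gt0. Qed.

Lemma cycle_weight_ge1 i : on_cycle s i0 i -> 1 <= w i.
Proof. by rewrite /cycle_pow => ->; apply: exprn_ege1; apply: ltW. Qed.

Lemma cycle_weight_ge0 i : 0 <= w i.
Proof. exact/cycle_pow_ge0/ltW. Qed.

Lemma cycle_weight_le_last i : w i <= w i0.
Proof.
rewrite /cycle_pow on_cycle_last //; case: ifP => [ci|_]; last first.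
  by rewrite exprn_ge0 // ltW.
apply: ler_weXn2l; first exact: ltW.
by rewrite cycle_index_last // -ltnS prednK ?cycle_length_gt0 ?cycle_index_lt.
Qed.

Lemma exists_leading_endomorphism : exists g : n.-tuple {mpoly k[n]},
  (forall i, leading_form w (theta * w i) (tnth f i) (tnth g i)) /\
  (forall i, i != i0 -> tnth g i = mvar k (s i)).
Proof.
have [g0 fg0] : exists g0, leading_form w (theta * w i0) (tnth f i0) g0.
  apply: leading_form_of_bounded; rewrite cycle_pow_last //.
  exact: exp_weight_le.
exists [tuple if i == i0 then g0 else mvar k (s i) | i < n].
split=> i; rewrite tnth_mktuple; last by move=> /negPf ->.
have [->//|ii0] := eqVneq i i0.
by rewrite f_shift // -cycle_pow_succ //; apply: leading_form_mvar.
Qed.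

(* The leading part [g] of [f] need not be dominant. Let [v] be the first variable
   along the cycle occurring in its entry of index [i0]: then [g] is dominant on
   the variables from [v] on, which is enough for its iterates not to vanish. *)
Lemma leading_endomorphism_iter_neq0 (g : n.-tuple {mpoly k[n]}) :
  (forall i, leading_form w (theta * w i) (tnth f i) (tnth g i)) ->
  (forall i, i != i0 -> tnth g i = mvar k (s i)) ->
  forall r, tnth (endo_iter g r) i0 != 0.
Proof.
move=> fg g_shift.
pose occurs j := on_cycle s i0 j && has (fun m : multinom n => m j != 0%N) (msupp (tnth g i0)).
have [v0 occ0] : exists j, occurs j.
  have [m fm mE] := exp_weight_attained.
  have gm : m \in msupp (tnth g i0).
    by apply: (leading_form_top (fg i0) fm); rewrite mE cycle_pow_last.
  (* If no cycle variable occurred, the monomial of weight [theta ^+ l] would have weight 0. *)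
  apply/existsP; apply: contraTT theta_gt0 => /existsPn noocc.
  rewrite -leNgt -(@ler_pXn2r _ l) ?cycle_length_gt0 ?nnegrE // ?(ltW theta_gt0) //.
  rewrite -mE /exp_weight big1 ?exprn_ge0 // => j _.
  have := noocc j; rewrite /occurs /cycle_pow; case: ifP => _ /=; last by rewrite mulr0.
  by move=> /hasPn/(_ m gm); rewrite negbK => /eqP ->; rewrite mul0r.
case: (@arg_minnP _ v0 occurs (cycle_index s i0) occ0) => v /andP[cv /hasP[mv gmv mvv]] vmin.
(* [S] also contains all indices off the cycle, their [cycle_index] being the cycle length. On the
   cycle, [s] moves away from [v] until [i0] is reached. *)
pose S := [set i | cycle_index s i0 v <= cycle_index s i0 i]%N.
have ltv := cycle_index_lt cv.
have sS i : i \in S -> i != i0 -> s i \in S :\ v.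
  rewrite !inE => iS ii0; have [ci|ci] := boolP (on_cycle s i0 i).
    have E := cycle_index_succ s_inj ci ii0.
    rewrite E leqW // andbT; apply: contraTneq iS => <-.
    by rewrite E -ltnNge.
  have csi : ~~ on_cycle s i0 (s i) by rewrite on_cycle_succ.
  by rewrite (cycle_index_off csi) (ltnW ltv) andbT; apply: contraNneq csi => ->.
have g0S : vars_in S (tnth g i0).
  move=> m gm i; rewrite inE -ltnNge => lt_iv; apply/eqP; apply: contraTT lt_iv => mi.
  rewrite -leqNgt; have [ci|/cycle_index_off->] := boolP (on_cycle s i0 i); last exact: ltnW.
  by apply: vmin; rewrite /occurs ci /=; apply/hasP; exists m.
have i0S : i0 \in S.
  by rewrite inE cycle_index_last // -ltnS prednK ?cycle_length_gt0.
move=> r; have : tnth (endo_iter g r) i0 != 0 /\ vars_in S (tnth (endo_iter g r) i0).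
  elim: r => [|r [IH0 IHS]].
    rewrite tnth_mktuple; split=> [|m]; first by rewrite -msupp_eq0 msuppX.
    rewrite msuppX inE => /eqP -> i iS; rewrite mnm1E.
    by apply/eqP; rewrite eqb0; apply: contraNneq iS => <-.
  rewrite endo_iterSr tnth_endo_comp; split.
    by apply: (comp_neq0 s i0 v S) => //; exists mv.
  exact: (vars_in_comp s i0 v S).
by case.
Qed.

Lemma iter_wbounded r i : wbounded w (theta ^+ r * w i) (tnth (endo_iter f r) i).
Proof.
have [g [fg _]] := exists_leading_endomorphism.
exact: leading_form_bounded (leading_form_iter theta_gt0 fg r i).
Qed.

(** The iterated leading form is nonzero at [i0], so each of its monomials has the extremal weight
    and survives in the iterate of [f]. *)
Lemma iter_weight_attained r : exists2 m,
  m \in msupp (tnth (endo_iter f r) i0) & exp_weight w m = theta ^+ r * w i0.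
Proof.
have [g [fg g_shift]] := exists_leading_endomorphism.
have top := leading_form_iter theta_gt0 fg r i0.
have gm := mlead_supp (leading_endomorphism_iter_neq0 g fg g_shift r).
exists (mlead (tnth (endo_iter g r) i0)); first exact: leading_form_msupp top gm.
exact: top.1 gm.
Qed.

(** As [i0] carries the largest weight, the weight of a monomial is at most its total degree times
    [w i0]. *)
Lemma le_endo_deg_iter r : theta ^+ r <= (endo_deg (endo_iter f r))%:R.
Proof.
have [m fm mE] := iter_weight_attained r.
rewrite -(ler_pM2r cycle_weight_last_gt0) -mE.
apply: (@le_trans _ _ ((mdeg m)%:R * w i0)).
  rewrite mdegE natr_sum mulr_suml; apply: ler_sum => j _.
  by rewrite ler_wpM2l ?cycle_weight_le_last.
apply: ler_wpM2r; first exact: cycle_weight_ge0.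
by rewrite ler_nat; apply: mdeg_le_endo_deg fm.
Qed.

(* The variables off the cycle contribute at most a constant [c] to the degree of
   each term of [f_{i0}]. The bound [K (2 theta^r - 1) w] absorbs it because
   [2 theta^(r+1) - 1] exceeds [theta (2 theta^r - 1)] by [theta - 1]. *)
Lemma endo_deg_iter_le : exists2 A : R,
  0 < A & forall r, (endo_deg (endo_iter f r))%:R <= A * theta ^+ r.
Proof.
pose c : R := (mmeasure (@mdeg n) (tnth f i0))%:R.
have c0 : 0 <= c by rewrite ler0n.
have theta1 : 0 < theta - 1 by rewrite subr_gt0.
pose K := 1 + c / (theta - 1).
have K1 : 1 <= K by rewrite lerDl divr_ge0 // ltW.
have K0 : 0 <= K := le_trans ler01 K1.
have Kc : c <= K * (theta - 1).
  by rewrite /K mulrDl mul1r divfK ?gt_eqF // lerDr ltW.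
pose off i : R := (~~ on_cycle s i0 i)%:R.
pose a r : R := K * (2 * theta ^+ r - 1).
have aS r : a r * theta + c <= a r.+1.
  rewrite -lerBrDl; apply: le_trans Kc _; rewrite /a exprSr.
  by rewrite le_eqVlt; apply/orP; left; apply/eqP; ring.
have bound r i : wbounded (fun _ => 1) (a r * w i + off i) (tnth (endo_iter f r) i).
  elim: r i => [|r IH] i.
    rewrite tnth_mktuple; apply: wsuppX; rewrite exp_weight1 /a expr0.
    have -> : 2 * 1 - 1 = 1 :> R by ring.
    rewrite mulr1 /off; case: (boolP (on_cycle s i0 i)) => [ci|_] /=.
      by rewrite addr0; apply: le_trans K1 _; rewrite ler_peMr ?cycle_weight_ge1.
    by rewrite lerDr mulr_ge0 ?cycle_weight_ge0.
  rewrite endo_iterS tnth_endo_comp; apply: (wbounded_comp _ IH).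
  have [->|ii0] := eqVneq i i0; last first.
    rewrite f_shift //; apply: wsuppX; rewrite exp_weight1 /off on_cycle_succ // lerD2r.
    rewrite cycle_pow_succ // mulrA ler_wpM2r ?cycle_weight_ge0 //.
    by apply: le_trans (aS r); rewrite lerDl.
  move=> m fm; apply: (@le_trans _ _ (a r * exp_weight w m + c)).
    rewrite /exp_weight mulr_sumr; under eq_bigr do rewrite mulrDr mulrCA.
    rewrite big_split lerD2l /=.
    apply: (@le_trans _ _ (mdeg m)%:R); last first.
      by rewrite ler_nat ltnW // mmeasure_mnm_lt.
    rewrite mdegE natr_sum; apply: ler_sum => j _.
    by rewrite ler_piMr // /off; case: on_cycle.
  rewrite /off on_cycle_last // addr0.
  have a0 : 0 <= a r.
    by rewrite mulr_ge0 // subr_ge0 -[leLHS]mul1r ler_pM // ?ler1n // exprn_ege1 // ltW.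
  apply: (@le_trans _ _ (a r * theta * w i0 + c * w i0)); last first.
    by rewrite -mulrDl ler_wpM2r ?cycle_weight_ge0.
  apply: lerD; last by rewrite ler_peMr ?cycle_weight_ge1 ?on_cycle_last.
  by rewrite -mulrA cycle_pow_last // ler_wpM2l // exp_weight_le.
(* The first summand comes from [a r <= 2 * K * theta ^+ r] and [w i <= w i0], the summand 1 from
   [off i <= 1 <= theta ^+ r]. *)
exists (2 * K * w i0 + 1) => [|r].
  by rewrite ltr_wpDl // !mulr_ge0 ?cycle_weight_ge0.
apply: endo_deg_le => [|i].
  by rewrite mulr_ge0 ?addr_ge0 ?mulr_ge0 ?cycle_weight_ge0 // exprn_ge0 // ltW.
apply: (wsuppW (bound r i)) => x /le_trans; apply.
have tr0 : 0 <= theta ^+ r by rewrite exprn_ge0 // ltW.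
rewrite mulrDl mul1r; apply: lerD.
  have -> : 2 * K * w i0 * theta ^+ r = (2 * K * theta ^+ r) * w i0 by ring.
  apply: (@le_trans _ _ (2 * K * theta ^+ r * w i)).
    rewrite ler_wpM2r ?cycle_weight_ge0 //.
    by rewrite /a mulrBr mulr1 mulrCA mulrA lerBlDr lerDl.
  by rewrite ler_wpM2l ?cycle_weight_le_last ?mulr_ge0.
by rewrite /off; case: on_cycle => //=; apply/exprn_ege1/ltW.
Qed.

Lemma dynamical_degree_eq :
  cvgn (degree_growth R f) /\ dynamical_degree R f = theta.
Proof.
have [A A0 le_A] := endo_deg_iter_le.
have lim_theta : (degree_growth R f @ \oo --> theta)%classic.
  by apply: (root_cvg_of_geometric theta_gt0 A0) => r; rewrite le_endo_deg_iter le_A.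
split; first by apply/cvg_ex; exists theta.
exact: cvg_lim.
Qed.

Lemma maximal_eigenvector_stable : exists mu : 'rV[R]_n,
  is_maximal_eigenvector f mu /\ algebraically_stable mu f.
Proof.
pose mu : 'rV[R]_n := \row_i w i.
have muE : mu 0 = w by apply/funext => i; rewrite mxE.
have endo_wdegE r : endo_wdeg mu (endo_iter f r) = (theta ^+ r)%:E.
  have [m fm mE] := iter_weight_attained r.
  apply: (endo_wdeg_eq mu (endo_iter f r) _ i0 m); rewrite ?muE //.
  - by rewrite exprn_ge0 // ltW.
  - by move=> j; apply: iter_wbounded.
  exact: cycle_weight_last_gt0.
have endo_wdeg1 : endo_wdeg mu f = theta%:E.
  rewrite -[theta]expr1 -endo_wdegE; congr endo_wdeg; apply: eq_from_tnth => i.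
  by rewrite tnth_endo_comp comp_mpoly_endo_id.
exists mu; split; last first.
  split=> [|r _]; first by rewrite endo_wdeg1 ltry.
  by rewrite endo_wdeg1 endo_wdegE EFin_expe.
split.
  split=> [i|]; first by rewrite muE cycle_weight_ge0.
  by apply: contraTneq cycle_weight_last_gt0 => mu0; rewrite -muE mu0 mxE ltxx.
exists theta; split=> // i.
have [->|ii0] := eqVneq i i0.
  have [m fm mE] := exp_weight_attained; rewrite muE cycle_pow_last // -mE.
  apply: (@wdeg_eq _ _ _ _ _ _ m); rewrite ?muE // mE.
  exact: exp_weight_le.
have fm : mnm1 (s i) \in msupp (tnth f i) by rewrite f_shift // msuppX mem_head.
rewrite muE -(cycle_pow_succ s_inj _ _ _ ii0) -[w (s i)]exp_weight1.
apply: (@wdeg_eq _ _ _ _ _ _ (mnm1 (s i))); rewrite ?muE // f_shift //.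
exact: wsuppX.
Qed.

End MaximalEigenvalue.

(** The entry of index [i] of the composite is the entry of index [s i] of the elementary map, so
    the exceptional index is the preimage under [s] of the last coordinate. *)
Lemma permutation_elementary_shift {k : fieldType} {n : nat} {f : n.-tuple {mpoly k[n]}} :
  (0 < n)%N -> is_permutation_elementary f ->
  exists (s : 'I_n -> 'I_n) (i0 : 'I_n), injective s /\
    forall i, i != i0 -> tnth f i = mvar k (s i).
Proof.
case: n f => // n f _ [a [e [a_perm e_elem ->]]].
have mvar_inj : injective (@mvar k n.+1).
  move=> i j /(congr1 (mcoeff (mnm1 i))) /eqP.
  rewrite !mcoeffX eqxx; have [E _|_] := eqVneq (mnm1 j); last by rewrite oner_eq0.
  have := congr1 (fun m : multinom n.+1 => m i) E; rewrite !mnm1E eqxx => /eqP.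
  by rewrite eqb1 eq_sym => /eqP.
have sP i : exists j, tnth a i == mvar k j.
  have := mem_tnth i a; rewrite a_perm.
  by move=> /tnthP[j ->]; exists j; rewrite tnth_mktuple.
pose s i := xchoose (sP i).
have aE i : tnth a i = mvar k (s i) := eqP (xchooseP (sP i)).
have s_surj (j : 'I_n.+1) : exists i, s i == j.
  have : mvar k j \in a by rewrite a_perm; apply/tnthP; exists j; rewrite tnth_mktuple.
  by move=> /tnthP[i +]; rewrite aE => /mvar_inj ->; exists i.
(* Equality of the sets of entries gives surjectivity; on a finite type a right inverse is
   two-sided. *)
have s_inj : injective s.
  pose t j := xchoose (s_surj j).
  have tK : cancel t s by move=> j; apply/eqP; exact: xchooseP (s_surj j).
  by apply: can_inj (canF_sym tK).
exists s, (xchoose (s_surj ord_max)); split=> // i ii0.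
rewrite tnth_endo_comp aE comp_mpoly_mvar; apply: e_elem.
rewrite ltn_neqAle ltn_ord andbT eqSS; apply: contraNneq ii0 => si.
apply/eqP/s_inj; rewrite (eqP (xchooseP (s_surj ord_max))); exact: val_inj.
Qed.

Theorem proposition3 (R : realType) (k : fieldType) (n : nat) (hn : (1 <= n)%N)
    (f : n.-tuple {mpoly k[n]})
    (f_aut : is_automorphism f) (f_pe : is_permutation_elementary f)
    (theta : R) (theta_max : is_maximal_eigenvalue f theta)
    (theta_gt1 : 1 < theta) :
  (exists mu : 'rV[R]_n,
      is_maximal_eigenvector f mu /\ algebraically_stable mu f) /\
  (cvgn (degree_growth R f) /\ dynamical_degree R f = theta) /\
  is_Handelman theta.
Proof.
have [s [i0 [s_inj f_shift]]] := permutation_elementary_shift hn f_pe.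
split; first exact: (maximal_eigenvector_stable s_inj f_shift theta_max theta_gt1).
split; first exact: (dynamical_degree_eq s_inj f_shift theta_max theta_gt1).
exact: (maximal_eigenvalue_Handelman s_inj f_shift theta_max theta_gt1).
Qed.
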